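(* Let $\mathcal{X}$ be a finite set, $U:\mathcal{X}\to\mathbb{R}$ a function with $\min_{x}U(x)=0$, and $Q$ the generator of an ergodic continuous-time Markov chain on $\mathcal{X}$ reversible with respect to its stationary distribution $\pi$. Let $$c_{M_i}:=\max_{x\neq y\in\mathcal{X}}\{H_i(x,y)-U(x)-U(y)\},\qquad i=1,2.$$ Then: (1) $c_{M_1}\geq c_{M_2}$. In particular, when $U$ does not have repeated values (i.e. $U$ is injective), $c_{M_1}>c_{M_2}$. (2) $c_{M_1}\geq 0$. (3) For each pair $x\neq y\in\mathcal{X}$ let $\gamma^{x,y}$ be a path from $x$ to $y$ achieving the lowest elevation, $\mathrm{Elev}_1(\gamma^{x,y})=H_1(x,y)$, let $U^{x,y}_{max}:=\{w\in\gamma^{x,y}:\ U(w)=\mathrm{Elev}_1(\gamma^{x,y})=H_1(x,y)\}$ and $$s^{x,y}:=\begin{cases}\max\{U(w):\ w\in\gamma^{x,y}\setminus U^{x,y}_{max}\}, & \text{if } |U^{x,y}_{max}|=1,\\ \mathrm{Elev}_1(\gamma^{x,y})=H_1(x,y), & \text{if } |U^{x,y}_{max}|>1.\end{cases}$$ If $s^{x,y}\leq U(x)+U(y)$ for all $x\neq y$, then $c_{M_2}\leq 0$. (4) Assume that $U$ does not have repeated values. Then the following are equivalent: $c_{M_2}<0$; $c_{M_1}=0$; $U$ has exactly $1$ local minimum (up to equivalence).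
   Context: $\mathcal{X}$ has at least two points. A path from $x$ to $y$ is any sequence $\gamma=(\gamma_i)_{i=0}^n$ of points with $\gamma_0=x$, $\gamma_n=y$ and $Q(\gamma_{i-1},\gamma_i)>0$ for $i=1,\ldots,n$; $\Gamma^{x,y}$ denotes the set of such paths, and $w\in\gamma$ means that $w$ is one of the points of $\gamma$. Define $$\mathrm{Elev}_1(\gamma)=\max_{0\le i\le n}U(\gamma_i),\qquad H_1(x,y)=\min_{\gamma\in\Gamma^{x,y}}\mathrm{Elev}_1(\gamma),$$ $$\mathrm{Elev}_2(\gamma)=\max_{1\le i\le n}\min\{U(\gamma_{i-1}),U(\gamma_i)\},\qquad H_2(x,y)=\min_{\gamma\in\Gamma^{x,y}}\mathrm{Elev}_2(\gamma).$$ Two states $x,y$ are equivalent if there is a path from $x$ to $y$ along which $U$ is constant. A point $x$ is a local minimum if either $\{y\in\mathcal{X}: U(y)<U(x)\}$ is empty, or for each $y$ with $U(y)<U(x)$ and each path $\gamma\in\Gamma^{x,y}$ there exists $z\in\gamma$ with $U(z)>U(x)$. *)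

(* Defs.v *)
From HB Require Import structures.
From mathcomp Require Import all_boot all_order all_algebra.
From mathcomp Require Import all_classical all_reals.

Set Implicit Arguments.
Unset Strict Implicit.
Unset Printing Implicit Defensive.

Import Order.TTheory GRing.Theory Num.Theory.

Local Open Scope classical_set_scope.
Local Open Scope ring_scope.

(* Maximum of a nonempty list; maxseq [::] = 0 is a junk value. *)
Definition maxseq (R : realType) (s : seq R) : R :=
  \big[Num.max/head 0 s]_(a <- s) a.

Section Chain.
Variables (R : realType) (X : finType).
Implicit Types (Q : X -> X -> R) (pi U : X -> R) (x y : X) (g : seq X).

Definition generator Q : Prop :=
  (forall x y, x != y -> 0 <= Q x y) /\ (forall x, \sum_y Q x y = 0).

Definition stationary_distribution Q pi : Prop :=
  [/\ forall x, 0 <= pi x, \sum_x pi x = 1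
    & forall y, \sum_x pi x * Q x y = 0].

Definition reversible Q pi : Prop :=
  forall x y, pi x * Q x y = pi y * Q y x.

(* A path is the full list of its points, starting point included; the
   one-point path [:: x] belongs to Gamma Q x x. *)
Definition Gamma Q x y : set (seq X) :=
  [set g | exists p, [/\ g = x :: p, path (fun a b => 0 < Q a b) x p
                       & last x p = y]].

(* Ergodic in the sense of irreducible; on a finite state space this already
   gives positive recurrence, and continuous time rules out periodicity. *)
Definition ergodic Q : Prop := forall x y, Gamma Q x y !=set0.

Definition Elev1 U g : R := maxseq [seq U z | z <- g].

(* zip g (behead g) lists the consecutive pairs (g_(i-1), g_i); it is empty
   only for one-point paths, which do not occur when x != y. *)
Definition Elev2 U g : R :=
  maxseq [seq Num.min (U e.1) (U e.2) | e <- zip g (behead g)].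

(* These infima are minima: see H1_attained and H2_attained. *)
Definition H1 Q U x y : R := inf [set Elev1 U g | g in Gamma Q x y].
Definition H2 Q U x y : R := inf [set Elev2 U g | g in Gamma Q x y].

Definition cM U (H : X -> X -> R) : R :=
  maxseq [seq H e.1 e.2 - U e.1 - U e.2
         | e <- enum [pred e : X * X | e.1 != e.2]].
Definition cM1 Q U : R := cM U (H1 Q U).
Definition cM2 Q U : R := cM U (H2 Q U).

Definition Umax U g : {set X} := [set w in g | U w == Elev1 U g]%SET.

Definition slevel U g : R :=
  if #|Umax U g| == 1%N then maxseq [seq U w | w <- g & w \notin Umax U g]
  else Elev1 U g.

Definition U_equiv Q U x y : Prop :=
  exists2 g, Gamma Q x y g & forall z, z \in g -> U z = U x.

Definition local_min Q U x : Prop :=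
  [set y | U y < U x] = set0 \/
  forall y, U y < U x -> forall g, Gamma Q x y g ->
    exists2 z, z \in g & U x < U z.

Definition unique_local_min Q U : Prop :=
  exists2 x, local_min Q U x & forall y, local_min Q U y -> U_equiv Q U x y.

End Chain.

Section Attained.
Variables (R : realType) (X : finType).

Lemma inf_in_finite (s : seq R) (A : set R) :
  A !=set0 -> (forall a, A a -> a \in s) -> A (inf A).
Proof.
move=> A0 As.
have [m Am lm] : exists2 m, A m & lbound A m.
  pose t := [seq a <- s | `[< A a >]].
  have tP a : (a \in t) <-> A a.
    rewrite mem_filter; split; first by case/andP => /asboolP.
    by move=> Aa; rewrite As // andbT; apply/asboolP.
  have [a0 /tP a0t] := A0.
  pose i0 : seq_sub t := SeqSub a0t.
  case: (@Order.TotalTheory.arg_minP _ _ _ i0 xpredT (fun i => ssval i)) => //.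
  move=> i _ imin; exists (ssval i); first by apply/tP; exact: ssvalP.
  by move=> a /tP at_; exact: (imin (SeqSub at_)).
suff -> : inf A = m by [].
apply/eqP; rewrite eq_le; apply/andP; split.
  by apply: ge_inf => //; exists m.
by apply: lb_le_inf => //; exists m.
Qed.

Lemma maxseq_mem (s : seq R) : maxseq s \in 0 :: s.
Proof.
case: s => [|a s]; first by rewrite /maxseq big_nil mem_head.
rewrite in_cons; apply/orP; right; rewrite /maxseq /= big_seq.
apply: (big_ind (fun v => v \in a :: s)) => //; first exact: mem_head.
by move=> u v us vs; rewrite maxEle; case: ifP.
Qed.

Lemma H1_attained (Q : X -> X -> R) (U : X -> R) (x y : X) :
  ergodic Q -> exists2 g, Gamma Q x y g & Elev1 U g = H1 Q U x y.
Proof.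
move=> /(_ x y) [g0 Gg0].
suff [g] : [set Elev1 U g | g in Gamma Q x y] (H1 Q U x y) by exists g.
apply: (@inf_in_finite (0 :: [seq U z | z <- enum X])).
  by exists (Elev1 U g0), g0.
move=> _ [g _ <-]; have := maxseq_mem [seq U z | z <- g].
rewrite !inE => /orP[-> //|/mapP[z _ Ez]].
by apply/orP; right; rewrite /Elev1 Ez map_f // mem_enum.
Qed.

Lemma H2_attained (Q : X -> X -> R) (U : X -> R) (x y : X) :
  ergodic Q -> exists2 g, Gamma Q x y g & Elev2 U g = H2 Q U x y.
Proof.
move=> /(_ x y) [g0 Gg0].
suff [g] : [set Elev2 U g | g in Gamma Q x y] (H2 Q U x y) by exists g.
apply: (@inf_in_finite (0 :: [seq U z | z <- enum X])).
  by exists (Elev2 U g0), g0.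
move=> _ [g _ <-].
have := maxseq_mem [seq Num.min (U e.1) (U e.2) | e <- zip g (behead g)].
rewrite !inE => /orP[-> //|/mapP[e _ Ee]].
apply/orP; right; rewrite /Elev2 Ee minEle.
by case: ifP => _; rewrite map_f // mem_enum.
Qed.

End Attained.

(* Main.v *)
Require Import Defs.
From mathcomp Require Import all_boot all_order all_algebra.
From mathcomp Require Import all_classical all_reals.

Set Implicit Arguments.
Unset Strict Implicit.
Unset Printing Implicit Defensive.

Import Order.TTheory GRing.Theory Num.Theory.

Local Open Scope ring_scope.

(** The proposition compares two ways of measuring the height of a path: by its
    highest point ([Elev1]) or by the lower endpoint of its highest edge
    ([Elev2]).  Since the diagonal of a generator is nonpositive, the two
    endpoints of an edge of a path are distinct.

    The lower endpoint of an edge is at most the highest point of the path,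
    whence [H2 <= H1]; when [U] is injective the two endpoints of an edge have
    distinct heights, so the inequality is strict.  This gives (1).  For (2),
    take a zero [x0] of [U] and any other [y]: every path from [x0] to [y] is at
    least as high as [y].  For (3), if a path attains its maximum at a single
    point, every edge has an endpoint away from that point, so [Elev2] is at
    most the second highest level; otherwise [slevel] is [Elev1].  Either way
    [Elev2 <= slevel] ([Elev2_le_slevel]), and the hypothesis bounds [H2 x y] by
    [U x + U y].

    For (4), the three conditions are proved in a cycle.  The first implication,
    from [cM1 = 0] to [cM2 < 0], is the strict case of (1).

    If [cM2 < 0], a local minimum [y] other than [x0] is impossible: no
    neighbour of [y] is lower than [y], so the first edge of any path from [y]
    to [x0] already gives [H2 y x0 >= U y = U y + U x0] ([local_min_H2_ge]).

    For injective [U], equivalent points are equal. If [x0] is the only local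
    minimum, every other point [x] has a path to a strictly lower point that
    never rises above [x]; iterating these descents leads from [x] to [x0]
    without rising above [U x] ([descent_to_min]). Following the descent from
    [x] and then, backwards, the one from [y], one gets [H1 x y <= max (U x) (U
    y) <= U x + U y], so [cM1 <= 0]. Walking backwards is possible because
    reversibility and irreducibility make the set of edges symmetric
    ([reversible_edge_sym]). *)

(** * Maxima and infima of finitely many reals *)

Section FiniteExtrema.
Variable R : realType.
Implicit Types (s : seq R) (a : R).

Lemma maxseq_ge s a : a \in s -> a <= maxseq s.
Proof. by move=> sa; apply: (@le_bigmax_seq _ _ _ _ _ a xpredT id). Qed.

Lemma maxseq_in s : s != [::] -> maxseq s \in s.
Proof.
case: s => // a s _; rewrite /maxseq /= big_seq.
apply: (big_ind (fun v => v \in a :: s)) => //; first exact: mem_head.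
by move=> u v us vs; rewrite maxEle; case: ifP.
Qed.

Lemma inf_le_finite s (A : set R) a :
  (forall b, A b -> b \in s) -> A a -> inf A <= a.
Proof.
move=> As Aa; apply: ge_inf => //.
have [m ms] : exists m, forall b, b \in s -> m <= b.
  elim: s {As} => [|b s [m ms]]; first by exists 0.
  exists (Num.min b m) => d; rewrite inE ge_min => /orP[/eqP->|/ms ->].
    by rewrite lexx.
  by rewrite orbT.
by exists m => b /As /ms.
Qed.

End FiniteExtrema.

Section Landscape.
Variables (R : realType) (X : finType) (Q : X -> X -> R) (U : X -> R).
Implicit Types (x y z : X) (g p : seq X).

(** * Paths *)

Lemma Gamma_cat x y z g h :
  Gamma Q x y g -> Gamma Q y z h -> Gamma Q x z (g ++ behead h).
Proof.
move=> [p [-> Qp yE]] [q [-> Qq zE]]; exists (p ++ q).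
by rewrite cat_path last_cat yE; split => //; apply/andP.
Qed.

Lemma Gamma_rev x y g :
  (forall a b, 0 < Q a b -> 0 < Q b a) ->
  Gamma Q x y g -> Gamma Q y x (rev g).
Proof.
move=> Qsym [p [-> Qp yE]]; exists (rev (belast x p)).
rewrite lastI rev_rcons yE; split=> //; last first.
  by case: p Qp yE => [|a p] _ /= yE; rewrite ?yE // rev_cons last_rcons.
by rewrite -yE rev_path; apply: sub_path Qp => a b; apply: Qsym.
Qed.

Lemma Gamma_ends x y g : Gamma Q x y g -> x \in g /\ y \in g.
Proof. by move=> [p [-> _ <-]]; rewrite mem_head mem_last. Qed.

Lemma mem_zip_path (e : rel X) x p (d : X * X) :
  path e x p -> d \in zip (x :: p) p ->
  [/\ d.1 \in x :: p, d.2 \in x :: p & e d.1 d.2].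
Proof.
elim: p x => // a p IHp x /= /andP[exa ap].
rewrite inE => /orP[/eqP->|/(IHp _ ap)[d1 d2 ed]].
  by rewrite /= !inE !eqxx orbT.
by rewrite !(in_cons x) d1 d2 !orbT.
Qed.

(** * Elevations *)

Lemma Elev1_ge g z : z \in g -> U z <= Elev1 U g.
Proof. by move=> gz; apply/maxseq_ge/map_f. Qed.

Lemma Elev1_attained x y g :
  Gamma Q x y g -> exists2 z, z \in g & Elev1 U g = U z.
Proof.
move=> [p [-> _ _]].
by have /mapP[z zg Ez] := @maxseq_in R [seq U z | z <- x :: p] isT; exists z.
Qed.

Lemma Elev2_attained x y g : x != y -> Gamma Q x y g ->
  exists a b, [/\ a \in g, b \in g, 0 < Q a b
                & Elev2 U g = Num.min (U a) (U b)].
Proof.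
move=> xy [[|w p] [-> Qp yE]]; first by rewrite -yE eqxx in xy.
pose mins := [seq Num.min (U e.1) (U e.2) | e <- zip (x :: w :: p) (w :: p)].
have /mapP[[a b] /(mem_zip_path Qp)[ag bg Qab] Eab] := @maxseq_in R mins isT.
by exists a, b.
Qed.

Lemma H1_le_Elev1 x y g : Gamma Q x y g -> H1 Q U x y <= Elev1 U g.
Proof.
move=> Gg; apply: (@inf_le_finite _ [seq U z | z <- enum X]); last by exists g.
move=> _ [h Gh <-]; have [z _ ->] := Elev1_attained Gh.
by rewrite map_f // mem_enum.
Qed.

Lemma H2_le_Elev2 x y g :
  x != y -> Gamma Q x y g -> H2 Q U x y <= Elev2 U g.
Proof.
move=> xy Gg.
apply: (@inf_le_finite _ [seq U z | z <- enum X]); last by exists g.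
move=> _ [h Gh <-]; have [a [b [_ _ _ ->]]] := Elev2_attained xy Gh.
by rewrite minEle; case: ifP => _; rewrite map_f // mem_enum.
Qed.

Lemma Elev2_le_Elev1 x y g :
  x != y -> Gamma Q x y g -> Elev2 U g <= Elev1 U g.
Proof.
move=> xy Gg; have [a [b [ag _ _ ->]]] := Elev2_attained xy Gg.
by rewrite ge_min Elev1_ge.
Qed.

(** * The maximum over pairs *)

Lemma cM_ge (H : X -> X -> R) x y :
  x != y -> H x y - U x - U y <= cM U H.
Proof.
move=> xy; apply: maxseq_ge.
by apply/mapP; exists (x, y); rewrite ?mem_enum.
Qed.

Lemma cM_attained (H : X -> X -> R) : (1 < #|X|)%N ->
  exists x y, x != y /\ cM U H = H x y - U x - U y.
Proof.
move=> /card_gt1P[x [y [_ _ xy]]].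
have /maxseq_in/mapP[[a b]] : [seq H e.1 e.2 - U e.1 - U e.2
    | e <- enum [pred e : X * X | e.1 != e.2]] != [::].
  have: (x, y) \in enum [pred e : X * X | e.1 != e.2] by rewrite mem_enum.
  by case: (enum _).
by rewrite mem_enum => ab Eab; exists a, b.
Qed.

(** * Edges of a generator *)

Hypothesis hQ : generator Q.

(** The off-diagonal entries of a row are nonnegative and the row sums to zero,
    so the diagonal entry cannot be positive. *)
Lemma generator_edge_neq a b : 0 < Q a b -> a != b.
Proof.
move=> Qab; apply/eqP => ab; rewrite -{b}ab in Qab.
have [Q0 /(_ a)] := hQ; rewrite (bigD1 a) //= => /eqP; apply/negP.
rewrite gt_eqF // ltr_pwDl // sumr_ge0 // => b ba.
by apply: Q0; rewrite eq_sym.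
Qed.

Lemma Elev2_lt_Elev1 x y g : injective U ->
  x != y -> Gamma Q x y g -> Elev2 U g < Elev1 U g.
Proof.
move=> Uinj xy Gg.
have [a [b [ag bg /generator_edge_neq ab ->]]] := Elev2_attained xy Gg.
have: U a != U b by rewrite (inj_eq Uinj).
rewrite gt_min neq_lt => /orP[lt_ab|lt_ba]; apply/orP; [left|right].
  exact: lt_le_trans lt_ab (Elev1_ge bg).
exact: lt_le_trans lt_ba (Elev1_ge ag).
Qed.

(** A maximal point that is alone on the path cannot be both endpoints of an
    edge, so each edge has an endpoint at or below the second level. *)
Lemma Elev2_le_slevel x y g :
  x != y -> Gamma Q x y g -> Elev2 U g <= slevel U g.
Proof.
move=> xy Gg; rewrite /slevel; case: ifP => [/cards1P[w Umax1]|_]; last first.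
  exact: Elev2_le_Elev1 Gg.
have [a [b [ag bg /generator_edge_neq ab ->]]] := Elev2_attained xy Gg.
have below z : z \in g -> z != w ->
    U z <= maxseq [seq U v | v <- g & v \notin Umax U g].
  by move=> zg zw; apply/maxseq_ge/map_f; rewrite mem_filter Umax1 inE zw.
rewrite ge_min; case: (eqVneq a w) => [aw|aw]; last by rewrite below.
by rewrite (below b) ?orbT // -aw eq_sym.
Qed.

Hypothesis hergo : ergodic Q.

(** Along an edge from a point of positive mass, detailed balance makes the
    reverse flow positive, hence also the mass of the other endpoint.  By
    irreducibility the mass is then positive everywhere. *)
Lemma reversible_edge_sym (pi : X -> R) :
  stationary_distribution Q pi -> reversible Q pi ->
  forall a b, 0 < Q a b -> 0 < Q b a.
Proof.
move=> [pi0 pi1 _] rev.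
have step a b : 0 < pi a -> 0 < Q a b -> 0 < pi b /\ 0 < Q b a.
  move=> pia Qab; have := mulr_gt0 pia Qab; rewrite rev.
  have := pi0 b; rewrite le_eqVlt => /orP[/eqP <-|pib].
    by rewrite mul0r ltxx.
  by rewrite pmulr_rgt0.
have [x pix] : exists x, 0 < pi x.
  apply: contrapT => npi; have: (0 : R) == 1.
    rewrite -pi1 big1 // => x _; apply/eqP; rewrite eq_le pi0 andbT leNgt.
    by apply/negP => pix; apply: npi; exists x.
  by rewrite eq_sym oner_eq0.
move=> a b Qab; apply: (proj2 (step a b _ Qab)).
have [_ [p [_ Qp <-]]] := hergo x a.
elim: p x pix Qp => //= z p IHp x pix /andP[Qxz Qp].
by apply: IHp Qp; have [] := step _ _ pix Qxz.
Qed.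

Lemma cM2_le_cM1 : (1 < #|X|)%N -> cM2 Q U <= cM1 Q U.
Proof.
move=> X1; have [x [y [xy]]] := cM_attained (H2 Q U) X1.
rewrite -/(cM2 Q U) => ->; apply: le_trans (cM_ge (H1 Q U) xy).
rewrite !lerD2r; have [g Gg <-] := H1_attained U x y hergo.
exact: le_trans (H2_le_Elev2 xy Gg) (Elev2_le_Elev1 xy Gg).
Qed.

Lemma cM2_lt_cM1 : (1 < #|X|)%N -> injective U -> cM2 Q U < cM1 Q U.
Proof.
move=> X1 Uinj; have [x [y [xy]]] := cM_attained (H2 Q U) X1.
rewrite -/(cM2 Q U) => ->; apply: lt_le_trans (cM_ge (H1 Q U) xy).
rewrite !ltrD2r; have [g Gg <-] := H1_attained U x y hergo.
exact: le_lt_trans (H2_le_Elev2 xy Gg) (Elev2_lt_Elev1 Uinj xy Gg).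
Qed.

Lemma cM1_ge0 x0 : (1 < #|X|)%N -> U x0 = 0 -> 0 <= cM1 Q U.
Proof.
move=> X1 U0; have [y x0y] : exists y, x0 != y.
  have [a [b [_ _ ab]]] := card_gt1P X1.
  by case: (eqVneq x0 a) => [->|?]; [exists b|exists a].
apply: le_trans (cM_ge (H1 Q U) x0y); rewrite U0 subr0 subr_ge0.
have [g Gg <-] := H1_attained U x0 y hergo.
by apply: Elev1_ge; have [] := Gamma_ends Gg.
Qed.

(** * Local minima and descents *)

Lemma global_local_min x0 : (forall x, U x0 <= U x) -> local_min Q U x0.
Proof.
move=> minx0; left; apply/seteqP; split=> // y /= yx0.
by have := minx0 y; rewrite leNgt yx0.
Qed.

(** A strictly lower neighbour would give a one-step descent from the local
    minimum [y], so on the first edge of any path starting at [y] the lower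
    height is that of [y]. *)
Lemma local_min_H2_ge y z :
  local_min Q U y -> y != z -> U y <= H2 Q U y z.
Proof.
move=> miny yz; have [g [p [-> Qp zE]] <-] := H2_attained U y z hergo.
case: p Qp zE => [_ /= zE|a p /= /andP[Qya _] _].
  by rewrite zE eqxx in yz.
have leya : U y <= U a.
  rewrite leNgt; apply/negP => ltay.
  case: miny => [none|/(_ a ltay [:: y; a])[]].
  - by have : [set y' | U y' < U y]%classic a by []; rewrite none.
  - by exists [:: a]; rewrite /= Qya.
  - move=> w; rewrite !inE => /orP[] /eqP ->; first by rewrite ltxx.
    by rewrite ltNge ltW.
rewrite -{1}(min_idPl leya); apply: maxseq_ge.
by apply/mapP; exists (y, a); rewrite ?mem_head.
Qed.

Lemma descent_step x : ~ local_min Q U x ->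
  exists y g, [/\ U y < U x, Gamma Q x y g & {in g, forall z, U z <= U x}].
Proof.
move=> nmin; apply: contrapT => nodesc; apply: nmin; right=> y yx g Gg.
apply: contrapT => nohigh; apply: nodesc; exists y, g; split=> // z zg.
by rewrite leNgt; apply/negP => xz; apply: nohigh; exists z.
Qed.

(** The induction is on the number of points strictly below [x], which drops at
    each descent. *)
Lemma descent_to_min x0 x : (forall y, local_min Q U y -> y = x0) ->
  exists2 g, Gamma Q x x0 g & {in g, forall z, U z <= U x}.
Proof.
move=> uniq_min; have [n] := ubnP #|[set y | U y < U x]%SET|.
elim: n x => // n IHn x ltn.
have [/uniq_min ->|/descent_step[y [g [yx Gg gx]]]] :=
  pselect (local_min Q U x).
  by exists [:: x0]; [exists [::] | move=> z; rewrite inE => /eqP->].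
have [|h Gh hy] := IHn y.
  rewrite -ltnS; apply: leq_trans ltn; rewrite ltnS; apply: proper_card.
  apply/properP; split.
    by apply/fintype.subsetP => z; rewrite !inE => /lt_trans; apply.
  by exists y; rewrite !inE ?ltxx.
exists (g ++ behead h); first exact: Gamma_cat Gg Gh.
move=> z; rewrite mem_cat => /orP[/gx //|/mem_behead/hy zy].
exact: le_trans zy (ltW yx).
Qed.

Lemma H1_le_max x0 x y :
  (forall a b, 0 < Q a b -> 0 < Q b a) ->
  (forall z, local_min Q U z -> z = x0) ->
  H1 Q U x y <= Num.max (U x) (U y).
Proof.
move=> Qsym uniq_min.
have [g Gg gx] := descent_to_min x uniq_min.
have [h Gh hy] := descent_to_min y uniq_min.
have Ggh := Gamma_cat Gg (Gamma_rev Qsym Gh).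
apply: le_trans (H1_le_Elev1 Ggh) _; have [z zgh ->] := Elev1_attained Ggh.
rewrite le_max; move: zgh; rewrite mem_cat => /orP[/gx -> //|/mem_behead].
by rewrite mem_rev => /hy ->; rewrite orbT.
Qed.

Lemma cM2_lt0_unique_local_min x0 :
  (forall x, 0 <= U x) -> U x0 = 0 -> cM2 Q U < 0 -> unique_local_min Q U.
Proof.
move=> U0 Ux0 cM2lt0.
exists x0; first by apply: global_local_min => x; rewrite Ux0.
move=> y miny; have [<-|yx0] := eqVneq y x0.
  by exists [:: y]; [exists [::] | move=> z; rewrite inE => /eqP->].
have := le_lt_trans (cM_ge (H2 Q U) yx0) cM2lt0.
by rewrite Ux0 subr0 subr_lt0 ltNge local_min_H2_ge.
Qed.

Lemma unique_local_min_cM1_le0 x0 : (1 < #|X|)%N -> injective U ->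
  (forall a b, 0 < Q a b -> 0 < Q b a) ->
  (forall x, 0 <= U x) -> U x0 = 0 -> unique_local_min Q U -> cM1 Q U <= 0.
Proof.
move=> X1 Uinj Qsym U0 Ux0 [m _ mP].
have equiv_eq y : U_equiv Q U m y -> y = m.
  by move=> [g Gg gm]; apply/Uinj/gm; have [] := Gamma_ends Gg.
have x0m : x0 = m.
  by apply/equiv_eq/mP/global_local_min => x; rewrite Ux0.
have uniq_min z : local_min Q U z -> z = x0.
  by rewrite x0m => /mP/equiv_eq.
have [x [y [_]]] := cM_attained (H1 Q U) X1; rewrite -/(cM1 Q U) => ->.
rewrite -addrA -opprD subr_le0; apply: le_trans (H1_le_max x y Qsym uniq_min) _.
by rewrite ge_max lerDl lerDr !U0.
Qed.

End Landscape.

Theorem proposition3p1 (R : realType) (X : finType) (U : X -> R)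
    (Q : X -> X -> R) (pi : X -> R)
    (hX : (1 < #|X|)%N)
    (hU : (forall x, 0 <= U x) /\ (exists x, U x = 0))
    (hQ : generator Q) (hergo : ergodic Q)
    (hpi : stationary_distribution Q pi) (hrev : reversible Q pi) :
  [/\ cM1 Q U >= cM2 Q U /\ (injective U -> cM1 Q U > cM2 Q U),
      cM1 Q U >= 0,
      forall gamma : X -> X -> seq X,
        (forall x y, x != y ->
           Gamma Q x y (gamma x y) /\ Elev1 U (gamma x y) = H1 Q U x y) ->
        (forall x y, x != y -> slevel U (gamma x y) <= U x + U y) ->
        cM2 Q U <= 0
    & injective U ->
        (cM2 Q U < 0 <-> cM1 Q U = 0) /\
        (cM1 Q U = 0 <-> unique_local_min Q U)].
Proof.
have [U0 [x0 Ux0]] := hU.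
have cM1ge0 : 0 <= cM1 Q U by exact: cM1_ge0 Ux0.
split=> //.
- by split; [exact: cM2_le_cM1 | exact: cM2_lt_cM1].
- move=> gamma gammaP slevel_le.
  have [x [y [xy]]] := cM_attained U (H2 Q U) hX; rewrite -/(cM2 Q U) => ->.
  have [Gg _] := gammaP x y xy.
  rewrite -addrA -opprD subr_le0; apply: le_trans (slevel_le x y xy).
  exact: le_trans (H2_le_Elev2 U xy Gg) (Elev2_le_slevel U hQ xy Gg).
- move=> Uinj.
  have to_cM2 : cM1 Q U = 0 -> cM2 Q U < 0.
    by move=> <-; exact: cM2_lt_cM1.
  have to_min : cM2 Q U < 0 -> unique_local_min Q U.
    exact: cM2_lt0_unique_local_min Ux0.
  have to_cM1 : unique_local_min Q U -> cM1 Q U = 0.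
    move=> umin; apply/eqP; rewrite eq_le cM1ge0 andbT.
    have Qsym := reversible_edge_sym hergo hpi hrev.
    exact: (unique_local_min_cM1_le0 hX Uinj Qsym U0 Ux0 umin).
  by split; split=> [|]; auto.
Qed.
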